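(* Let $G$ be a group that surjects onto the free group $F_2$ of rank $2$, and let $\phi\in \mathrm{Out}(G)$ have finite order. Then there exist a finite index normal subgroup $N\trianglelefteq G$ and an outer automorphism $\psi\in\mathrm{Out}(N)$ such that $\psi$ acts non-trivially on $H_1(N)$ and $$\iota_*\circ\psi_*=\phi_*\circ\iota_* : H_1(N)\to H_1(G),$$ where $\iota:N\to G$ is the inclusion.
   Context: $H_1(\cdot)$ denotes the abelianization (first integral homology) of a group; $\psi_*$, $\phi_*$, $\iota_*$ denote the maps induced on $H_1$ by $\psi$, $\phi$, $\iota$ (inner automorphisms act trivially on $H_1$, so outer automorphisms induce well-defined maps). *)

(* Defs.v *)
From HB Require Import structures.
From mathcomp Require Import all_boot.
From mathcomp Require Import boolp classical_sets functions cardinality.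

Set Implicit Arguments.
Unset Strict Implicit.
Unset Printing Implicit Defensive.

Local Open Scope group_scope.
Local Open Scope quotient_scope.
Local Open Scope classical_set_scope.

(* Groups are MathComp's [groupType]s (no finiteness).  A subgroup is a        *)
(* boolean predicate with a [groupClosed] structure; classically every subset *)
(* of the carrier is such a predicate.                                        *)

HB.mixin Record isConjgClosed (G : groupType) (S : {pred G}) := {
  gpredJr : forall x y : G, x \in S -> x ^ y \in S
}.

#[short(type="normalSubgroup")]
HB.structure Definition NormalSubgroup (G : groupType) :=
  {S of isConjgClosed G S & GroupClosed G S}.

HB.factory Record isNormalSubgroup (G : groupType) (S : {pred G}) := {
  normal_group_closed : group_closed S;
  normal_conjg : forall x y : G, x \in S -> x ^ y \in S
}.

HB.builders Context G S of isNormalSubgroup G S.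

HB.instance Definition _ :=
  isMulClosed.Build G S (group_closedM normal_group_closed).
HB.instance Definition _ := isMul1Closed.Build G S normal_group_closed.1.
HB.instance Definition _ :=
  isInvClosed.Build G S (group_closedV normal_group_closed).
HB.instance Definition _ := isConjgClosed.Build G S normal_conjg.

HB.end.

Section Subgroup.
Variables (G : groupType) (N : groupClosed G).

Record subgroup := Subgroup { subgroup_val : G; _ : subgroup_val \in N }.

HB.instance Definition _ := [isSub for subgroup_val].
HB.instance Definition _ := [Choice of subgroup by <:].

Fact subgroup_closed : group_closed N.
Proof. by split; [exact: gpred1 | move=> x y xN yN; exact: gpredF]. Qed.

HB.instance Definition _ :=
  SubChoice_isSubGroup.Build G [in N] subgroup subgroup_closed.

Definition inclusion : UMagmaMorphism.type subgroup G :=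
  (val : subgroup -> G).

Lemma inclusion_inj : injective inclusion.
Proof. exact: val_inj. Qed.

Lemma inclusionP (x : G) : reflect (exists y, inclusion y = x) (x \in N).
Proof.
apply: (iffP idP) => [xN|[y <-]]; first by exists (Subgroup xN).
exact: valP.
Qed.

End Subgroup.

Section Coset.
Variables (G : groupType) (N : groupClosed G).

Definition coset_rel : rel G := fun x y => x^-1 * y \in N.

Fact coset_rel_refl : reflexive coset_rel.
Proof. by move=> x; rewrite /coset_rel mulVg gpred1. Qed.

Fact coset_rel_sym : symmetric coset_rel.
Proof. by move=> x y; rewrite /coset_rel -gpredV invgM invgK. Qed.

Fact coset_rel_trans : transitive coset_rel.
Proof.
move=> y x z xy yz; rewrite /coset_rel.
by rewrite -[z](mulVKg y) mulgA gpredM.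
Qed.

Canonical coset_equiv :=
  EquivRel coset_rel coset_rel_refl coset_rel_sym coset_rel_trans.

(* The set G/N of left cosets xN. *)
Definition coset := {eq_quot coset_equiv}.
HB.instance Definition _ := Choice.on coset.
HB.instance Definition _ := EqQuotient.on coset.

Lemma eq_coset (x y : G) : (x = y %[mod coset]) <-> (x^-1 * y \in N).
Proof. by split=> [/eqP|h]; [|apply/eqP]; rewrite eqmodE. Qed.

Lemma coset_ind (P : coset -> Prop) :
  (forall x, P (\pi_coset x)) -> forall c, P c.
Proof. by move=> Ppi c; rewrite -[c]reprK. Qed.

Definition finite_index : Prop := finite_set [set: coset].

End Coset.

Section Quotient.
Variables (G : groupType) (N : normalSubgroup G).
Implicit Types c d e : coset N.

Definition coset_mul c d : coset N := \pi_(coset N) (repr c * repr d).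
Definition coset_one : coset N := \pi_(coset N) 1.
Definition coset_inv c : coset N := \pi_(coset N) (repr c)^-1.

Lemma repr_coset (x : G) : x^-1 * repr (\pi_(coset N) x) \in N.
Proof. by apply/eq_coset; rewrite reprK. Qed.

Lemma coset_piM x y :
  coset_mul (\pi_(coset N) x) (\pi_(coset N) y) = \pi_(coset N) (x * y).
Proof.
apply/esym/eq_coset; have hx := repr_coset x; have hy := repr_coset y.
set x' := repr _ in hx *; set y' := repr _ in hy *.
suff -> : (x * y)^-1 * (x' * y') = (x^-1 * x') ^ y * (y^-1 * y').
  by rewrite gpredM // gpredJr.
by rewrite invgM conjgE !mulgA mulgK.
Qed.

Lemma coset_piV x : coset_inv (\pi_(coset N) x) = \pi_(coset N) x^-1.
Proof.
apply/esym/eq_coset; have hx := repr_coset x; set x' := repr _ in hx *.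
rewrite invgK -gpredV invgM invgK.
suff -> : x' * x^-1 = (x^-1 * x') ^ x^-1 by rewrite gpredJr.
by rewrite conjgE invgK !mulgA mulgV mul1g.
Qed.

Fact coset_mulA : associative coset_mul.
Proof.
move=> c d e; elim/coset_ind: c => x; elim/coset_ind: d => y; elim/coset_ind: e => z.
by rewrite !coset_piM mulgA.
Qed.

Fact coset_mul1 : left_id coset_one coset_mul.
Proof. by move=> c; elim/coset_ind: c => x; rewrite coset_piM mul1g. Qed.

Fact coset_mulr1 : right_id coset_one coset_mul.
Proof. by move=> c; elim/coset_ind: c => x; rewrite coset_piM mulg1. Qed.

Fact coset_mulV : left_inverse coset_one coset_inv coset_mul.
Proof. by move=> c; elim/coset_ind: c => x; rewrite coset_piV coset_piM mulVg. Qed.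

Fact coset_mulrV : right_inverse coset_one coset_inv coset_mul.
Proof. by move=> c; elim/coset_ind: c => x; rewrite coset_piV coset_piM mulgV. Qed.

HB.instance Definition _ := isGroup.Build (coset N)
  coset_mulA coset_mul1 coset_mulr1 coset_mulV coset_mulrV.

End Quotient.

Section H1.
Variable G : groupType.

(* The subgroup generated by the commutators. *)
Definition commutator_set : set G :=
  smallest (fun A : set G => group_closed [in A])
    [set z | exists x y : G, z = [~ x, y]].
Definition commutator_subgroup : {pred G} := [in commutator_set].

Lemma mem_commutator x y : [~ x, y] \in commutator_subgroup.
Proof. by apply/mem_set => A [_ sA]; apply: sA; exists x, y. Qed.

Fact commutator_closed : group_closed commutator_subgroup.
Proof.
split; first by apply/mem_set => A [[A1 _] _]; exact/set_mem/A1.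
move=> x y /set_mem hx /set_mem hy; apply/mem_set => A hA.
have [[_ AF] _] := hA.
by apply/set_mem/AF; apply/mem_set; [exact: hx | exact: hy].
Qed.

Fact commutator_conjg x y :
  x \in commutator_subgroup -> x ^ y \in commutator_subgroup.
Proof.
move=> hx; rewrite -(mulVKg x (x ^ y)) -commgEl.
exact: (group_closedM commutator_closed hx (mem_commutator x y)).
Qed.

HB.instance Definition _ := isNormalSubgroup.Build G commutator_subgroup
  commutator_closed commutator_conjg.

Definition H1 : groupType := coset commutator_subgroup.
Definition H1_class (x : G) : H1 := \pi_(coset commutator_subgroup) x.

Lemma H1_mulC (a b : H1) : a * b = b * a.
Proof.
elim/coset_ind: a => x; elim/coset_ind: b => y.
rewrite [LHS]coset_piM [RHS]coset_piM; apply/eq_coset.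
by rewrite invgM -mulgA mem_commutator.
Qed.

End H1.

Arguments commutator_subgroup : clear implicits.

Section H1map.
Variables (G H : groupType) (f : UMagmaMorphism.type G H).

Definition H1map (c : H1 G) : H1 H := H1_class (f (repr c)).

Lemma commutator_morph x :
  x \in commutator_subgroup G -> f x \in commutator_subgroup H.
Proof.
pose A := [set z | f z \in commutator_subgroup H].
move=> /set_mem h; suff : A x by []; apply: h; split.
  split=> [|u v /set_mem hu /set_mem hv]; apply/mem_set; rewrite /A /=.
    by rewrite gmulf1 gpred1.
  by rewrite gmulfF gpredF.
by move=> _ [u [v ->]]; rewrite /A /= gmulfR mem_commutator.
Qed.

Lemma H1mapE (x : G) : H1map (H1_class x) = H1_class (f x).
Proof.
apply/esym/eq_coset; rewrite -gmulfV -gmulfM commutator_morph //.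
exact: repr_coset.
Qed.

End H1map.

Section Aut.
Variable G : groupType.

Record aut := MkAut {
  aut_fun :> G -> G;
  aut_morph : {morph aut_fun : x y / x * y};
  aut_bij : bijective aut_fun
}.

HB.instance Definition _ := gen_eqMixin aut.
HB.instance Definition _ := gen_choiceMixin aut.

Fact aut_morphF (f : aut) : {morph f : x y / x / y}.
Proof.
move=> x y; have f1 : f 1 = 1 by apply: (mulgI (f 1)); rewrite -aut_morph !mulg1.
rewrite aut_morph; congr (_ * _); apply: (mulgI (f y)).
by rewrite -aut_morph !mulgV.
Qed.

HB.instance Definition _ (f : aut) :=
  isGroupMorphism.Build G G (aut_fun f) (aut_morphF f).

Lemma autP (f g : aut) : f =1 g -> f = g.
Proof.
case: f g => [f fM fB] [g gM gB] /= /funext efg.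
by rewrite -{}efg in gM gB *; congr MkAut; exact: Prop_irrelevance.
Qed.

Fact aut_one_bij : bijective (@id G).
Proof. by exists id. Qed.

Definition aut_one : aut := MkAut (fun _ _ => erefl) aut_one_bij.

Fact aut_comp_morph (f g : aut) : {morph f \o g : x y / x * y}.
Proof. by move=> x y /=; rewrite !aut_morph. Qed.

Definition aut_comp (f g : aut) : aut :=
  MkAut (aut_comp_morph f g) (bij_comp (aut_bij f) (aut_bij g)).

Fact aut_inverse (f : aut) : exists g : G -> G, cancel f g /\ cancel g f.
Proof. by have [g] := aut_bij f; exists g. Qed.

Definition aut_inv_fun (f : aut) : G -> G := projT1 (cid (aut_inverse f)).

Fact aut_invK (f : aut) : cancel f (aut_inv_fun f).
Proof. exact: (projT2 (cid (aut_inverse f))).1. Qed.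

Fact aut_invVK (f : aut) : cancel (aut_inv_fun f) f.
Proof. exact: (projT2 (cid (aut_inverse f))).2. Qed.

Definition aut_inv (f : aut) : aut :=
  MkAut (can2_gmulfM (aut_invK f) (aut_invVK f))
        (Bijective (aut_invVK f) (aut_invK f)).

Fact aut_mulA : associative aut_comp.
Proof. by move=> f g h; apply: autP. Qed.

Fact aut_mul1 : left_id aut_one aut_comp.
Proof. by move=> f; apply: autP. Qed.

Fact aut_mulr1 : right_id aut_one aut_comp.
Proof. by move=> f; apply: autP. Qed.

Fact aut_mulV : left_inverse aut_one aut_inv aut_comp.
Proof. by move=> f; apply: autP => x; exact: aut_invK. Qed.

Fact aut_mulrV : right_inverse aut_one aut_inv aut_comp.
Proof. by move=> f; apply: autP => x; exact: aut_invVK. Qed.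

HB.instance Definition _ :=
  isGroup.Build aut aut_mulA aut_mul1 aut_mulr1 aut_mulV aut_mulrV.

Lemma aut_mulE (f g : aut) (x : G) : (f * g) x = f (g x).
Proof. by []. Qed.

Definition inner_set : set aut := [set f | exists a : G, forall x, f x = x ^ a].
Definition inner_aut : {pred aut} := [in inner_set].

Fact inner_closed : group_closed inner_aut.
Proof.
split; first by apply/mem_set; exists 1 => x; rewrite conjg1.
move=> f g /set_mem[a fa] /set_mem[b gb]; apply/mem_set; exists (b^-1 * a) => x.
rewrite aut_mulE fa conjgM; congr (_ ^ a).
by apply: (conjg_inj b); rewrite conjgKV -gb [LHS]aut_invVK.
Qed.

Fact inner_conjg (f g : aut) : f \in inner_aut -> f ^ g \in inner_aut.
Proof.
move=> /set_mem[a fa]; apply/mem_set; exists (g^-1 a) => x.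
rewrite conjgE !aut_mulE fa (gmulfJ (g^-1)); congr (_ ^ _).
exact: aut_invK.
Qed.

HB.instance Definition _ := isNormalSubgroup.Build aut inner_aut
  inner_closed inner_conjg.

Definition Out : groupType := coset inner_aut.
Definition Out_class (f : aut) : Out := \pi_(coset inner_aut) f.

(* The action of an outer automorphism on H_1, through any representative:   *)
(* see [Out_H1E].                                                             *)
Definition Out_H1 (phi : Out) : H1 G -> H1 G :=
  H1map (repr phi : aut).

Lemma Out_H1E (f : aut) : Out_H1 (Out_class f) =1 H1map f.
Proof.
rewrite /Out_H1; set g : aut := repr _.
have /set_mem[a fga] : f^-1 * g \in inner_aut by exact: repr_coset.
elim/coset_ind=> x; rewrite [LHS]H1mapE [RHS]H1mapE.
transitivity (H1_class (f (x ^ a))).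
  by congr H1_class; rewrite -fga aut_mulE [RHS]aut_invVK.
apply/esym/eq_coset; rewrite -gmulfV -gmulfM -commgEl gmulfR.
exact: mem_commutator.
Qed.

End Aut.

Arguments inner_aut : clear implicits.

(* The free group on X: reduced words in the letters (x, true), standing for  *)
(* the generator x, and (x, false), standing for its inverse.                 *)
Section FreeGroup.
Variable X : choiceType.
Implicit Types (a b : X * bool) (s t u : seq (X * bool)).

Definition letter_inv a : X * bool := (a.1, ~~ a.2).

Definition reduced s : bool := sorted (fun a b => b != letter_inv a) s.

Record free_group := FreeWord { free_word : seq (X * bool); _ : reduced free_word }.

HB.instance Definition _ := [isSub for free_word].
HB.instance Definition _ := [Choice of free_group by <:].

Definition free_cons a s : seq (X * bool) :=
  if s is b :: t then (if b == letter_inv a then t else a :: s) else [:: a].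

(* Concatenation followed by free reduction, if t is reduced. *)
Definition free_cat s t : seq (X * bool) := foldr free_cons t s.

Definition word_inv s : seq (X * bool) := rev (map letter_inv s).

Lemma letter_invK : involutive letter_inv.
Proof. by case=> x b; rewrite /letter_inv /= negbK. Qed.

Lemma reduced_behead a s : reduced (a :: s) -> reduced s.
Proof. exact: path_sorted. Qed.

Lemma reduced_cons a s : reduced s -> reduced (free_cons a s).
Proof.
case: s => //= b s rs; case: eqVneq => [_|nab] /=; first exact: path_sorted rs.
by rewrite nab.
Qed.

Lemma reduced_cat s t : reduced t -> reduced (free_cat s t).
Proof. by move=> rt; elim: s => //= a s; exact: reduced_cons. Qed.

Lemma free_consK a s :
  reduced s -> free_cons (letter_inv a) (free_cons a s) = s.
Proof.
case: s => [_|b s /= rs] /=; first by rewrite letter_invK eqxx.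
case: eqVneq => [eb|nab] /=; last by rewrite letter_invK eqxx.
case: s rs => [_|c s /= /andP[+ _]]; rewrite eb //=.
by move=> /negPf ->.
Qed.

Lemma free_consVK a s :
  reduced s -> free_cons a (free_cons (letter_inv a) s) = s.
Proof. by move=> rs; rewrite -{1}[a]letter_invK free_consK. Qed.

Lemma reduced_free_cons a s : reduced (a :: s) -> free_cons a s = a :: s.
Proof. by case: s => //= b s /andP[/negPf ->]. Qed.

Lemma free_cat_cons a s t :
  reduced t -> free_cat (free_cons a s) t = free_cons a (free_cat s t).
Proof.
move=> rt; case: s => //= b s; case: eqVneq => //= ->.
by rewrite free_consVK // reduced_cat.
Qed.

Lemma free_catA s t u :
  reduced u -> free_cat s (free_cat t u) = free_cat (free_cat s t) u.
Proof. by move=> ru; elim: s => //= a s ->; rewrite free_cat_cons. Qed.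

Lemma free_cats0 s : reduced s -> free_cat s [::] = s.
Proof.
elim: s => //= a s IHs rs.
by rewrite IHs ?(reduced_behead rs) // reduced_free_cons.
Qed.

Lemma word_invK : involutive word_inv.
Proof.
move=> s; rewrite /word_inv map_rev revK -map_comp -[RHS]map_id.
by apply: eq_map => a; exact: letter_invK.
Qed.

Lemma reduced_inv s : reduced s -> reduced (word_inv s).
Proof.
rewrite /reduced /word_inv rev_sorted sorted_map; apply: sub_sorted => a b /=.
by apply: contra_neq => ->; rewrite letter_invK.
Qed.

Lemma free_cat_rcons s a t : free_cat (rcons s a) t = free_cat s (free_cons a t).
Proof. by rewrite /free_cat foldr_rcons. Qed.

Lemma free_catVs s t : reduced t -> free_cat (word_inv s) (free_cat s t) = t.
Proof.
move=> rt; elim: s => //= a s IHs.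
by rewrite /word_inv /= rev_cons free_cat_rcons free_consK ?reduced_cat.
Qed.

Definition free_mul (v w : free_group) : free_group :=
  FreeWord (reduced_cat (free_word v) (valP w)).
Definition free_one : free_group := @FreeWord [::] isT.
Definition free_inv (w : free_group) : free_group :=
  FreeWord (reduced_inv (valP w)).

Fact free_mulA : associative free_mul.
Proof. by move=> u v w; apply/val_inj/free_catA/(valP w). Qed.

Fact free_mul1 : left_id free_one free_mul.
Proof. by move=> w; exact: val_inj. Qed.

Fact free_mulr1 : right_id free_one free_mul.
Proof. by move=> w; apply/val_inj/free_cats0/(valP w). Qed.

Fact free_mulV : left_inverse free_one free_inv free_mul.
Proof.
move=> w; apply: val_inj => /=.
by rewrite -{2}(free_cats0 (valP w)) free_catVs.
Qed.

Fact free_mulrV : right_inverse free_one free_inv free_mul.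
Proof.
move=> w; apply: val_inj => /=.
rewrite -{1}[free_word w]word_invK -[X in free_cat _ X]free_cats0.
  exact: free_catVs.
exact/reduced_inv/(valP w).
Qed.

HB.instance Definition _ := isGroup.Build free_group
  free_mulA free_mul1 free_mulr1 free_mulV free_mulrV.

Definition free_gen (x : X) : free_group := @FreeWord [:: (x, true)] isT.

(* The universal property of the free group. *)
Section Universal.
Variables (G : groupType) (g : X -> G).

Definition letter_val a : G := if a.2 then g a.1 else (g a.1)^-1.
Definition free_lift (w : free_group) : G :=
  \prod_(a <- free_word w) letter_val a.

Lemma free_lift_cons a s :
  \prod_(b <- free_cons a s) letter_val b
  = letter_val a * \prod_(b <- s) letter_val b.
Proof.
case: s => [|b s] /=; first by rewrite big_seq1 big_nil mulg1.
case: eqVneq => [->|_]; last by rewrite big_cons.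
rewrite big_cons mulgA; suff -> : letter_val a * letter_val (letter_inv a) = 1.
  by rewrite mul1g.
by rewrite /letter_val /=; case: a.2; rewrite (mulgV, mulVg).
Qed.

Lemma free_liftM : {morph free_lift : v w / v * w}.
Proof.
move=> v w; rewrite /free_lift /=; elim: (free_word v) => [|a s IHs] /=.
  by rewrite big_nil mul1g.
by rewrite free_lift_cons IHs big_cons mulgA.
Qed.

Lemma free_lift_gen x : free_lift (free_gen x) = g x.
Proof. exact: big_seq1. Qed.

Lemma free_lift_unique (f : UMagmaMorphism.type free_group G) :
  (forall x, f (free_gen x) = g x) -> f =1 free_lift.
Proof.
move=> fg w; pose v s := \prod_(a <- s)
  (if a.2 then free_gen a.1 else (free_gen a.1)^-1) : free_group.
have vE s : reduced s -> val (v s) = s.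
  elim: s => [|a s IHs] rs; first by rewrite /v big_nil.
  rewrite /v big_cons /= -/(v s); case: a rs => x [] rs /=;
    by rewrite IHs ?(reduced_behead rs) // reduced_free_cons.
have -> : w = v (free_word w) by apply/val_inj/esym/vE/(valP w).
rewrite /free_lift (vE _ (valP w)) gmulf_prod; apply: eq_bigr => -[x []] _ /=.
  exact: fg.
by rewrite gmulfV fg.
Qed.

End Universal.

End FreeGroup.

Definition F2 : groupType := free_group 'I_2.

(* Main.v *)
Require Import Defs.
From HB Require Import structures.
From mathcomp Require Import all_boot.
From mathcomp Require Import boolp classical_sets functions cardinality.
From mathcomp Require Import ssralg ssrint.
From mathcomp Require Import zify.

Set Implicit Arguments.
Unset Strict Implicit.
Unset Printing Implicit Defensive.

(* Since F_2 surjects onto the infinite dihedral group D = Z >| {1, -1}, so    *)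
(* does G, by some q.  Let chi : G -> Z/2 be the reflection character, let f   *)
(* represent phi, with f^n inner, and let N be the intersection of the kernels *)
(* of chi o f^i for i < n.  As characters do not see inner automorphisms, N is *)
(* f-invariant.  It contains all squares, and q maps it into the translations, *)
(* hence kills [N, N].  If a maps to the unit translation and b to a           *)
(* reflection, then a^2 and its conjugate by b are in N and are mapped to the  *)
(* translations by 2 and -2, so conjugation by b is not trivial on H_1(N).     *)
(* Therefore f|N and f|N o conj_b are not both trivial on H_1(N), while both   *)
(* induce phi_* on the image of H_1(N) in H_1(G).                              *)

(** The finite order of [phi] serves to make the family of characters finite: [f] permutes them
    cyclically ([mem_chi_kernel_aut]), so their common kernel N is stable under [f] and of finite
    index ([chi_kernel_finite_index]). The dihedral quotient certifies that conjugation by [b] moves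
    a class of H_1(N) ([commutator_abelian]), and [Out_lift] turns such a class into [psi]. *)

Local Open Scope group_scope.

(* (z, s) stands for the isometry x |-> z + (-1)^s x of the integers. *)
Definition dihedral : Type := int * bool.
HB.instance Definition _ := Choice.on dihedral.

Section Dihedral.
Implicit Types x y : dihedral.

Definition dihedral_mul x y : dihedral :=
  ((x.1 + (if x.2 then - y.1 else y.1))%R, x.2 (+) y.2).
Definition dihedral_one : dihedral := (0%R, false).
Definition dihedral_inv x : dihedral := ((if x.2 then x.1 else - x.1)%R, x.2).

Fact dihedral_mulA : associative dihedral_mul.
Proof.
by move=> [x []] [y []] [z []]; congr (_, _); rewrite /=; lia.
Qed.

Fact dihedral_mul1 : left_id dihedral_one dihedral_mul.
Proof. by move=> [x s]; congr (_, _); rewrite /=; lia. Qed.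

Fact dihedral_mulr1 : right_id dihedral_one dihedral_mul.
Proof. by move=> [x []]; congr (_, _); rewrite /=; lia. Qed.

Fact dihedral_mulV : left_inverse dihedral_one dihedral_inv dihedral_mul.
Proof. by move=> [x []]; congr (_, _); rewrite /=; lia. Qed.

Fact dihedral_mulrV : right_inverse dihedral_one dihedral_inv dihedral_mul.
Proof. by move=> [x []]; congr (_, _); rewrite /=; lia. Qed.

HB.instance Definition _ := isGroup.Build dihedral
  dihedral_mulA dihedral_mul1 dihedral_mulr1 dihedral_mulV dihedral_mulrV.

Lemma translation_mulC x y : x.2 = false -> y.2 = false -> x * y = y * x.
Proof.
by case: x y => [x s] [y t] /= -> ->; congr (_, _); rewrite /=; lia.
Qed.

End Dihedral.

Section Restriction.
Variables (G : groupType) (N : groupClosed G) (f : aut G).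
Hypothesis fN : forall x, (f x \in N) = (x \in N).

Fact restrict_subproof (x : subgroup N) : f (val x) \in N.
Proof. by rewrite fN (valP x). Qed.

Definition restrict_fun x : subgroup N := Subgroup (restrict_subproof x).

Fact restrict_morph : {morph restrict_fun : x y / x * y}.
Proof. by move=> x y; apply: val_inj; exact: aut_morph. Qed.

Fact restrict_bij : bijective restrict_fun.
Proof.
(* An equivalence in [fN], rather than one inclusion, is what makes N stable under [f^-1] too. *)
have fVN (x : subgroup N) : f^-1 (val x) \in N.
  by rewrite -fN [f _]aut_invVK (valP x).
exists (fun x => Subgroup (fVN x)) => x; apply: val_inj.
  exact: aut_invK.
exact: aut_invVK.
Qed.

Definition aut_restrict : aut (subgroup N) := MkAut restrict_morph restrict_bij.

End Restriction.

Section Conjugation.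
Variables (G : groupType) (a : G).

Fact conj_bij : bijective (fun x : G => x ^ a).
Proof. by exists (fun x => x ^ a^-1) => x; [exact: conjgK | exact: conjgKV]. Qed.

Definition conj_aut : aut G := MkAut (fun x y => conjMg x y a) conj_bij.

End Conjugation.

Lemma Out_classX (G : groupType) (f : aut G) n :
  Out_class (f ^+ n) = Out_class f ^+ n.
Proof. by elim: n => // n IHn; rewrite !expgS -IHn [RHS]coset_piM. Qed.

Lemma H1_class_conj (G : groupType) (x a : G) : H1_class (x ^ a) = H1_class x.
Proof. by apply/esym/eq_coset; rewrite -commgEl mem_commutator. Qed.

Lemma H1_ind (G : groupType) (P : H1 G -> Prop) :
  (forall x, P (H1_class x)) -> forall c, P c.
Proof. exact: coset_ind. Qed.

Lemma mem_normal_conj (G : groupType) (N : normalSubgroup G) (x a : G) :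
  (x ^ a \in N) = (x \in N).
Proof.
by apply/idP/idP => [/gpredJr-/(_ a^-1)|/gpredJr//]; rewrite conjgK.
Qed.

(** Inner on G but possibly outer on N: it may move H_1(N), yet it becomes invisible in H_1(G). *)
Definition conj_restrict (G : groupType) (N : normalSubgroup G) (a : G) :
    aut (subgroup N) :=
  aut_restrict (f := conj_aut a) (fun x => mem_normal_conj N x a).

(** If the restriction of [phi] already acts non-trivially on H_1(N), it serves as [psi]. Otherwise
    composing it with conjugation by [b] gives the action of that conjugation, which moves the class
    of [y]. *)
Lemma Out_lift (G : groupType) (N : normalSubgroup G) (phi : Out G) (b : G)
    (y : subgroup N) :
  (forall x, (((repr phi : aut G) : G -> G) x \in N) = (x \in N)) ->
  H1_class (conj_restrict N b y) <> H1_class y ->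
  exists psi : Out (subgroup N),
    (exists c, Out_H1 psi c <> c) /\
    (forall c, H1map (inclusion N) (Out_H1 psi c)
               = Out_H1 phi (H1map (inclusion N) c)).
Proof.
move=> fN yb; pose u := aut_restrict fN.
have [[c uc]|/forallNP u1] := pselect (exists c, H1map u c <> c).
  exists (Out_class u); split; first by exists c; rewrite Out_H1E.
  by apply: H1_ind => x; rewrite Out_H1E /Out_H1 (H1mapE (inclusion N) x) !H1mapE.
exists (Out_class (u * conj_restrict N b)); split.
  exists (H1_class y); rewrite Out_H1E H1mapE.
  by have /contrapT := u1 (H1_class (conj_restrict N b y)); rewrite H1mapE => ->.
apply: H1_ind => x; rewrite Out_H1E /Out_H1 (H1mapE (inclusion N) x) !H1mapE /=.
by rewrite gmulfJ H1_class_conj.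
Qed.

(** Only the image of [q] has to be commutative, so that [H] may be the dihedral group. *)
Lemma commutator_abelian (G H : groupType) (q : UMagmaMorphism.type G H) :
  (forall x y, q x * q y = q y * q x) ->
  forall z, z \in commutator_subgroup G -> q z = 1.
Proof.
move=> qC z /set_mem zC; suff : [set w | q w = 1]%classic z by [].
apply: zC; split.
  split=> [|u v /set_mem qu /set_mem qv]; apply/mem_set => /=.
    exact: gmulf1.
  by rewrite gmulfF qu qv divg1.
by move=> _ [u [v ->]] /=; rewrite gmulfR; apply/eqP/commgP/qC.
Qed.

Section InvariantSubgroup.
Variables (G : groupType) (q : UMagmaMorphism.type G dihedral).
Variables (f : aut G) (n : nat).

(** The reflection character pulled back along [f ^+ i], with Z/2 written as [bool] under xor. *)
Definition chi i x : bool := (q ((f ^+ i) x)).2.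

Lemma chi1 i : chi i 1 = false.
Proof. by rewrite /chi !gmulf1. Qed.

Lemma chiM i : {morph chi i : x y / x * y >-> x (+) y}.
Proof. by move=> x y; rewrite /chi !gmulfM. Qed.

Lemma chiV i x : chi i x^-1 = chi i x.
Proof. by rewrite /chi !gmulfV. Qed.

Lemma chiJ i x y : chi i (x ^ y) = chi i x.
Proof. by rewrite conjgE !chiM chiV addbC addbK. Qed.

Definition chi_kernel : {pred G} := [pred x | [forall i : 'I_n, ~~ chi i x]].

Lemma chi_kernelP x :
  reflect (forall i, i < n -> chi i x = false) (x \in chi_kernel).
Proof.
apply: (iffP forallP) => h i; last by rewrite h.
by move=> lt_in; have /negPf := h (Ordinal lt_in).
Qed.

Fact chi_kernel_closed : group_closed chi_kernel.
Proof.
split=> [|x y /chi_kernelP hx /chi_kernelP hy]; apply/chi_kernelP => i lt_in.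
  exact: chi1.
by rewrite chiM chiV hx ?hy.
Qed.

Fact chi_kernel_conjg x y : x \in chi_kernel -> x ^ y \in chi_kernel.
Proof.
by move=> /chi_kernelP hx; apply/chi_kernelP => i lt_in; rewrite chiJ hx.
Qed.

HB.instance Definition _ := isNormalSubgroup.Build G chi_kernel
  chi_kernel_closed chi_kernel_conjg.

Lemma chi_kernel_finite_index : finite_index chi_kernel.
Proof.
(* The values of the [n] characters embed G/N into the finite set (Z/2)^n. *)
pose h (c : coset chi_kernel) := [ffun i : 'I_n => chi i (repr c)].
rewrite /finite_index -(preimage_setT h); apply: finite_preimage => //.
move=> c d _ _ /ffunP hcd; rewrite -[c]reprK -[d]reprK.
apply/eq_coset/chi_kernelP => i lt_in.
have := hcd (Ordinal lt_in); rewrite !ffunE /= => hi.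
by rewrite chiM chiV hi addbb.
Qed.

Lemma chi_kernel_sqr x : x * x \in chi_kernel.
Proof. by apply/chi_kernelP => i _; rewrite chiM addbb. Qed.

Hypotheses (n_gt0 : 0 < n) (fn_inner : f ^+ n \in inner_aut G).

(** [f ^+ n] is a conjugation, which characters do not see. *)
Lemma chi_period x : chi n x = chi 0 x.
Proof.
have /set_mem[a fa] := fn_inner.
by rewrite {1}/chi fa -[RHS](chiJ 0 x a).
Qed.

(** Precomposition with [f] sends [chi i] to [chi i.+1], and [chi_period] closes the cycle. *)
Lemma mem_chi_kernel_aut x : (f x \in chi_kernel) = (x \in chi_kernel).
Proof.
have chiS i : chi i (f x) = chi i.+1 x by rewrite /chi expgSr.
apply/chi_kernelP/chi_kernelP => h i lt_in.
  case: i lt_in => [_|i lt_in]; last by rewrite -chiS h // ltnW.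
  by rewrite -chi_period -(prednK n_gt0) -chiS h // prednK.
rewrite chiS; have [lt_Sin|] := ltnP i.+1 n; first exact: h.
by move=> le_nSi; rewrite (_ : i.+1 = n) ?chi_period ?h //; lia.
Qed.

End InvariantSubgroup.

Lemma free_lift_is_morphism (X : choiceType) (G : groupType) (g : X -> G) :
  {morph free_lift g : x y / x / y}.
Proof.
move=> x y; apply: (mulIg (free_lift g y)).
by rewrite -free_liftM !divgK.
Qed.

HB.instance Definition _ (X : choiceType) (G : groupType) (g : X -> G) :=
  isGroupMorphism.Build (free_group X) G (free_lift g)
    (free_lift_is_morphism g).

Theorem theorem1p4 (G : groupType)
    (G_onto_F2 : exists p : UMagmaMorphism.type G F2,
       forall w : F2, exists x : G, p x = w)
    (phi : Out G)
    (phi_finite_order : exists n : nat, (0 < n)%N /\ (phi ^+ n)%g = 1%g) :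
  exists N : normalSubgroup G,
    finite_index N /\
    exists psi : Out (subgroup N),
      (exists c : H1 (subgroup N), Out_H1 psi c <> c) /\
      (forall c : H1 (subgroup N),
         H1map (inclusion N) (Out_H1 psi c)
         = Out_H1 phi (H1map (inclusion N) c)).
Proof.
have [p p_onto] := G_onto_F2; have [n [n_gt0 phin]] := phi_finite_order.
pose gen (i : 'I_2) : dihedral := if i == ord0 then (1%R, false) else (0%R, true).
pose q : UMagmaMorphism.type G dihedral := free_lift gen \o p.
have q_gen i : exists x, q x = gen i.
  by have [x px] := p_onto (free_gen i); exists x; rewrite /q /= px free_lift_gen.
have [a qa] := q_gen ord0; have [b qb] := q_gen ord_max.
pose f : aut G := repr phi.
have fn_inner : f ^+ n \in inner_aut G.
  (* In the form [1^-1 * f ^+ n], membership says that [f ^+ n] has trivial class in [Out G]. *)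
  rewrite -[f ^+ n]mul1g -invg1; apply/eq_coset.
  by rewrite -/(Out_class _) -/(Out_class _) Out_classX /Out_class reprK phin.
exists (chi_kernel q f n : normalSubgroup G); split; first exact: chi_kernel_finite_index.
apply: (Out_lift (b := b) (y := Subgroup (chi_kernel_sqr q f n a))).
  exact: mem_chi_kernel_aut.
move=> /eq_coset h.
pose r : UMagmaMorphism.type _ dihedral := q \o inclusion (chi_kernel q f n).
have r_translation x : (r x).2 = false.
  (* Since [n] is positive, [chi 0], the reflection character of [q] itself, vanishes on N. *)
  by have /chi_kernelP/(_ 0 n_gt0) := valP x.
have : (q ((a * a) ^ b))^-1 * q (a * a) = 1.
  rewrite -gmulfV -gmulfM; apply: (commutator_abelian (q := r)) h => x y.
  exact: translation_mulC.
(* The left side computes to the translation by 2 + 2 = 4, which is not the identity. *)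
by rewrite gmulfJ gmulfM qa qb.
Qed.
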